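(* Let $n>1$ and let $\Gamma=\mathrm{Cay}(\mathbb{Z}^n;S)$ be a non-empty, locally finite Cayley (di)graph on $\mathbb{Z}^n$ (i.e. $S$ is finite and non-empty). Let $H=\langle S\rangle\le\mathbb{Z}^n$. Let $\mathrm{Stab}_{\mathrm{Aut}(H)}(S)$ be the group of all automorphisms of $H$ that fix $S$ setwise, and let $\mathrm{Aut}(H)_{\mathbb{Z}^n}$ be the group of all automorphisms of $H$ that can be extended to automorphisms of $\mathbb{Z}^n$. Then $\Gamma$ is a (D)CI-graph if and only if both of the following hold: (i) the number of connected components of $\Gamma$ (or of its underlying undirected graph, in the directed case) is finite and square-free; and (ii) $\mathrm{Aut}(H)=\mathrm{Aut}(H)_{\mathbb{Z}^n}\cdot\mathrm{Stab}_{\mathrm{Aut}(H)}(S)$, i.e. every automorphism of $H$ is a product $\tau_1\tau_2$ with $\tau_1\in\mathrm{Aut}(H)_{\mathbb{Z}^n}$ and $\tau_2\in\mathrm{Stab}_{\mathrm{Aut}(H)}(S)$.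
   Context: For a group $G$ and a subset $S\subseteq G\setminus\{e\}$, the Cayley digraph $\mathrm{Cay}(G;S)$ has vertex set $G$ and an arc from $g$ to $gs$ for all $g\in G$, $s\in S$; if $S=S^{-1}$ it is regarded as an undirected Cayley graph. The digraph $\mathrm{Cay}(G;S)$ is a DCI-graph if whenever $S'\subseteq G\setminus\{e\}$ and $\mathrm{Cay}(G;S)\cong\mathrm{Cay}(G;S')$ as digraphs, there is a group automorphism $\alpha$ of $G$ with $\alpha(S)=S'$. An undirected Cayley graph (so $S=S^{-1}$) is a CI-graph if the same holds for all $S'=S'^{-1}$. The notation ''(D)CI'' means that the statement holds both for undirected graphs with ''CI'' and for digraphs with ''DCI''. *)

(* Defs.v *)
From HB Require Import structures.
From Stdlib Require Import Relation_Operators.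
From mathcomp Require Import all_boot all_algebra.
From mathcomp Require Import boolp classical_sets functions cardinality.

Set Implicit Arguments.
Unset Strict Implicit.
Unset Printing Implicit Defensive.

Import GRing.Theory.
Local Open Scope classical_set_scope.
Local Open Scope ring_scope.

(* A digraph on V is given by its arc relation; an undirected graph is a digraph
   whose arc relation is symmetric, so both have the same isomorphisms. *)
Definition digraph_iso (V W : Type) (a : V -> V -> Prop) (b : W -> W -> Prop) :
    Prop :=
  exists f : V -> W, bijective f /\ forall x y, a x y <-> b (f x) (f y).

Definition components (V : Type) (a : V -> V -> Prop) : set (set V) :=
  range (fun x => [set y | clos_refl_sym_trans V a x y]).

Definition squarefree (k : nat) : Prop := forall d, (d ^ 2 %| k)%N -> d = 1%N.

(* Written additively: the arcs are g -> g + s. *)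
Definition Cay (G : zmodType) (S : set G) : G -> G -> Prop :=
  fun g h => exists2 s, S s & h = g + s.

Definition symmetric_set (G : zmodType) (S : set G) : Prop := -%R @` S = S.

Definition Aut (G : zmodType) : set (G -> G) :=
  [set f | zmod_morphism f /\ bijective f].

Arguments Aut : clear implicits.

Definition is_DCI (G : zmodType) (S : set G) : Prop :=
  forall S' : set G, ~ S' 0 -> digraph_iso (Cay S) (Cay S') ->
  exists2 f, Aut G f & f @` S = S'.

Definition is_CI (G : zmodType) (S : set G) : Prop :=
  forall S' : set G, ~ S' 0 -> symmetric_set S' ->
  digraph_iso (Cay S) (Cay S') ->
  exists2 f, Aut G f & f @` S = S'.

Definition gen (G : zmodType) (S : set G) : set G :=
  smallest [set A : set G | zmod_closed (fun x => x \in A)] S.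

Lemma gen_zmod_closed (G : zmodType) (S : set G) :
  zmod_closed (fun x => x \in gen S).
Proof.
split; first by apply/mem_set => A [[A0 _] _]; exact: set_mem A0.
move=> x y /set_mem xS /set_mem yS; apply/mem_set => A [[A0 AB] SA].
by apply/set_mem/AB; apply/mem_set; [apply: xS|apply: yS].
Qed.

Definition gen_pred (G : zmodType) (S : set G) : G -> bool :=
  fun x => x \in gen S.

HB.instance Definition _ (G : zmodType) (S : set G) :=
  GRing.isZmodClosed.Build G (gen_pred S) (gen_zmod_closed S).

Record gen_type (G : zmodType) (S : set G) :=
  GenType { gen_val : G; _ : gen_pred S gen_val }.

HB.instance Definition _ (G : zmodType) (S : set G) :=
  [isSub for @gen_val G S].
HB.instance Definition _ (G : zmodType) (S : set G) :=
  [Choice of gen_type S by <:].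
HB.instance Definition _ (G : zmodType) (S : set G) :=
  [SubChoice_isSubZmodule of gen_type S by <:].

Definition Aut_ext (G : zmodType) (S : set G) : set (gen_type S -> gen_type S) :=
  [set t | Aut (gen_type S) t /\
     exists2 f, Aut G f & forall h, f (gen_val h) = gen_val (t h)].

Definition Stab (G : zmodType) (S : set G) : set (gen_type S -> gen_type S) :=
  [set t | Aut (gen_type S) t /\
     t @` (@gen_val G S @^-1` S) = @gen_val G S @^-1` S].

Arguments Aut_ext {G} S.
Arguments Stab {G} S.

(* Main.v *)
From HB Require Import structures.
Require Import Defs.
From Stdlib Require Import Relation_Operators.
From mathcomp Require Import all_boot all_order all_algebra.
From mathcomp Require Import boolp classical_sets functions cardinality.
From mathcomp Require Import zify ring lra.

(** The components of a Cayley digraph Cay(G; S) are the cosets of the subgroup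
    H generated by S, all isomorphic to Cay(H; S). Hence any injective
    homomorphism phi : H -> G for which H and phi(H) have equally many cosets
    extends, one coset at a time, to an isomorphism
    Cay(G; S) -> Cay(G; phi(S)) ([digraph_iso_image]).

    Over Z^n with S finite there are no other isomorphisms, up to translation
    ([arc_preserving_additive]). If f is an isomorphism onto Cay(Z^n; S'), then
    f(x + S) = f(x) + S' for every x, so the sum over s in S of f(x + s) - f(x)
    is constant in x. Consequently every coordinate of the difference
    x |-> f(x + h) - f(x), with h in S, is harmonic: |S| times its value at x is
    the sum of its values on x + S. It is also an integer valued bounded
    function, because the difference lies in the finite set S'. A bounded
    harmonic integer valued function u is invariant under translation by every t
    in S: the function u(x + t) - u(x) is again harmonic and bounded, so it
    attains its maximum M; by the maximum principle it equals M along the whole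
    ray x0, x0 + t, x0 + 2t and so on, where u therefore grows linearly with
    slope M, and boundedness of u gives M <= 0; the same applies to - u. Thus
    f(x + h) - f(x) depends only on the coset of x, which means that f - f(0) is
    additive on H.

    The (D)CI property is thereby squeezed between two purely algebraic
    statements. On the one hand it implies that, for every embedding phi of H
    into Z^n that preserves the index, some automorphism of Z^n carries S to
    phi(S) ([realizes_embeddings]). Three choices of phi give the two conditions.
    - phi = doubling. If H had infinite index, so would 2H, and an automorphism
      carrying S to 2S would make every element of S divisible by all powers
      of 2.
    - The Smith normal form presents H, in suitable coordinates, as the lattice
      of vectors whose i-th coordinate is divisible by d_i, with d_1 | ... | d_n,
      and its index is the product k of the |d_i|. Then phi can rescale H
      onto the lattice with moduli (k, 1, 1, ...) or onto the one with moduli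
      (e, k/e, 1, ...) when e^2 | k. Both would be images of H under
      automorphisms of Z^n, but k/e annihilates only the second quotient,
      unless e = 1.
    - phi an automorphism of H gives the factorization of Aut(H).

    Conversely, when k is square-free the divisibility chain forces
    d_1, ..., d_(n-1) to be units, so any two finitely generated subgroups of
    index k are exchanged by an automorphism of Z^n
    ([squarefree_lattice_aut]). An isomorphism Cay(Z^n; S) -> Cay(Z^n; S') then
    differs from such an automorphism by an automorphism of H, and the
    factorization of the latter supplies the automorphism of Z^n carrying S to
    S' ([is_DCI_of_lattice_aut]). *)

Set Implicit Arguments.
Unset Strict Implicit.
Unset Printing Implicit Defensive.

Import Order.TTheory GRing.Theory Num.Theory.
Local Open Scope classical_set_scope.
Local Open Scope ring_scope.

(** * Generated subgroups and the components of a Cayley digraph *)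

Section Gen.
Variables (G : zmodType) (S : set G).
Implicit Types (x y : G).

Lemma sub_gen : S `<=` gen S.
Proof. by move=> x Sx A [_]; apply. Qed.

Lemma gen0 : gen S 0.
Proof. by apply/set_mem; case: (gen_zmod_closed S). Qed.

Lemma genB x y : gen S x -> gen S y -> gen S (x - y).
Proof.
move=> /mem_set xS /mem_set yS; apply/set_mem.
by case: (gen_zmod_closed S) => _; apply.
Qed.

Lemma genN x : gen S x -> gen S (- x).
Proof. by move=> ?; rewrite -sub0r; apply: genB => //; exact: gen0. Qed.

Lemma genD x y : gen S x -> gen S y -> gen S (x + y).
Proof. by move=> ? ?; rewrite -[y]opprK; apply: genB => //; exact: genN. Qed.

Lemma genBC x y : gen S (x - y) -> gen S (y - x).
Proof. by move=> /genN; rewrite opprB. Qed.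

(** The induction principle of the generated subgroup. *)
Lemma gen_min (A : set G) : S `<=` A -> A 0 ->
  (forall x y, A x -> A y -> A (x - y)) -> gen S `<=` A.
Proof.
move=> SA A0 AB x; apply; split=> //; split; first exact/mem_set.
by move=> u v /set_mem uA /set_mem vA; apply/mem_set/AB.
Qed.

Definition coset_of_gen x : set G := [set y | gen S (y - x)].

Lemma coset_eqP x y : coset_of_gen x = coset_of_gen y <-> gen S (x - y).
Proof.
split=> [e|xy].
  have : coset_of_gen x x by rewrite /coset_of_gen /= subrr; exact: gen0.
  by rewrite e.
apply/seteqP; split=> z /= h.
  by have := genD h xy; rewrite addrA subrK.
by have := genB h xy; rewrite opprB addrA subrK.
Qed.

(** A subgroup absorbs undirected walks, and conversely the set of h such that
    every x is joined to x + h is a subgroup containing S. *)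
Lemma connectedE x y : clos_refl_sym_trans G (Cay S) x y <-> gen S (y - x).
Proof.
split.
  elim=> {x y} [x _ [s Ss ->]|x|x y _|x y z _ h1 _ h2].
  - by rewrite addrAC subrr add0r; exact: sub_gen.
  - by rewrite subrr; exact: gen0.
  - exact: genBC.
  - by have := genD h2 h1; rewrite addrA subrK.
pose A := [set h | forall x, clos_refl_sym_trans G (Cay S) x (x + h)].
suff gA : gen S `<=` A by move=> /gA /(_ x); rewrite addrCA subrr addr0.
apply: gen_min => [s Ss z|z|h k hA kA z].
- by apply: rst_step; exists s.
- by rewrite addr0; apply: rst_refl.
- apply: (@rst_trans _ _ _ (z + h)); first exact: hA.
  by apply: rst_sym; have := kA (z + (h - k)); rewrite -addrA subrK.
Qed.

Lemma componentsE : components (Cay S) = range coset_of_gen.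
Proof.
rewrite /components; congr (_ @` _); apply/funext => x.
by apply/seteqP; split=> y /= /connectedE.
Qed.

End Gen.

Lemma inj_surj_bijective (T U : Type) (f : T -> U) :
  injective f -> (forall y, exists x, f x = y) -> bijective f.
Proof.
move=> f_inj f_surj; rewrite -setTT_bijective; split=> // [x y _ _|y _].
  exact: f_inj.
by have [x <-] := f_surj y; exists x.
Qed.

(** Homomorphisms defined on a subgroup are represented by functions on the whole
    group that are additive there, with no constraint elsewhere. *)
Definition additive_on (G G' : zmodType) (H : set G) (phi : G -> G') :=
  forall x y, H x -> H y -> phi (x - y) = phi x - phi y.

Section AdditiveOn.
Variables (G G' : zmodType) (S : set G) (phi : G -> G').
Hypothesis phiB : additive_on (gen S) phi.

Lemma additive_on0 : phi 0 = 0.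
Proof. by rewrite -(subrr 0) phiB ?subrr //; exact: gen0. Qed.

Lemma additive_onN x : gen S x -> phi (- x) = - phi x.
Proof.
by move=> Sx; rewrite -sub0r phiB ?additive_on0 ?sub0r //; exact: gen0.
Qed.

Lemma additive_onD x y : gen S x -> gen S y -> phi (x + y) = phi x + phi y.
Proof.
move=> Sx Sy; rewrite -[in LHS](opprK y) phiB ?additive_onN ?opprK //.
exact: genN.
Qed.

(** Additivity is only available on the subgroup, so the inductions range over
    the elements of the subgroup that satisfy the claim. *)
Lemma gen_image : phi @` gen S = gen (phi @` S).
Proof.
apply/seteqP; split=> [_ [x Sx <-]|].
  pose A := [set x | gen S x /\ gen (phi @` S) (phi x)].
  suff /(_ _ Sx)[] : gen S `<=` A by [].
  apply: gen_min => [s Ss||u v [uS uA] [vS vA]].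
  - by split; apply: sub_gen => //; exists s.
  - by split; rewrite ?additive_on0; exact: gen0.
  - by split; [exact: genB|rewrite phiB //; exact: genB].
apply: gen_min => [_ [s Ss <-]||_ _ [u Su <-] [v Sv <-]].
- by exists s => //; exact: sub_gen.
- by exists 0; [exact: gen0|exact: additive_on0].
- by exists (u - v); [exact: genB|rewrite phiB].
Qed.

End AdditiveOn.

Definition injective_on_gen (G G' : zmodType) (S : set G) (phi : G -> G') :=
  forall x, gen S x -> phi x = 0 -> x = 0.

(** With a representative r(C) chosen in every coset C and a bijection theta
    between the two sets of cosets, the isomorphism sends r(C) + h to
    r(theta(C)) + phi(h). *)
Lemma digraph_iso_image (G : zmodType) (S : set G) (phi : G -> G) :
  additive_on (gen S) phi -> injective_on_gen S phi ->
  (components (Cay S) #= components (Cay (phi @` S)))%card ->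
  digraph_iso (Cay S) (Cay (phi @` S)).
Proof.
move=> phiB phi_inj; set S' := phi @` S; rewrite !componentsE.
move=> /card_set_bijP [theta [thetaS theta_inj theta_surj]].
pose c := coset_of_gen S; pose c' := coset_of_gen S'.
have cP x : range c (c x) by exists x.
pose r (C : set G) : G := xget 0 C.
have rP x : gen S (x - r (c x)).
  have h : c x (r (c x)).
    by apply: xgetPex; exists x; rewrite /c /coset_of_gen /= subrr; exact: gen0.
  exact: (genBC h).
have r'P C : range c' C -> c' (r C) = C.
  case=> x _ <-; have h : c' x (r (c' x)).
    apply: xgetPex; exists x; rewrite /c' /coset_of_gen /= subrr.
    exact: gen0.
  exact: (coset_eqP S' _ _).2 h.
pose f x := r (theta (c x)) + phi (x - r (c x)).
have c'f x : c' (f x) = theta (c x).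
  rewrite -[RHS]r'P; last exact: thetaS.
  apply/coset_eqP; rewrite /f addrAC subrr add0r -gen_image //.
  by exists (x - r (c x)).
have finj x y : f x = f y -> x = y.
  move=> fxy; have /theta_inj ec : theta (c x) = theta (c y).
    by rewrite -!c'f fxy.
  have {}ec : c x = c y by apply: ec; exact/mem_set.
  move: fxy; rewrite /f ec => /addrI e.
  have Sx : gen S (x - r (c y)) by rewrite -ec.
  have exy : x - y = (x - r (c y)) - (y - r (c y)).
    by rewrite opprB addrA subrK.
  apply/eqP; rewrite -subr_eq0 exy; apply/eqP/phi_inj.
    by apply: genB => //; exact: rP.
  by rewrite phiB // e subrr.
have fadd x s : S s -> f (x + s) = f x + phi s.
  move=> Ss; have ec : c (x + s) = c x.
    by apply/coset_eqP; rewrite addrAC subrr add0r; exact: sub_gen.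
  by rewrite /f ec addrAC (additive_onD phiB (rP x) (sub_gen Ss)) addrA.
exists f; split.
  apply: inj_surj_bijective => [x y|y]; first exact: finj.
  have /theta_surj [_ [x0 _ <-] ex0] : range c' (c' y) by exists y.
  have : gen S' (y - r (c' y)).
    by apply/coset_eqP; apply/esym/(r'P (c' y)); exists y.
  rewrite -gen_image // => -[h Sh eh].
  exists (r (c x0) + h) => //.
  have ec : c (r (c x0) + h) = c x0.
    apply/coset_eqP; rewrite addrAC; apply: genD => //.
    exact: genBC (rP x0).
  by rewrite /f ec ex0 [_ + h]addrC addrK eh addrC subrK.
move=> x y; split=> [[s Ss ->]|[_ [s Ss <-]]].
  by exists (phi s); [exists s|exact: fadd].
by rewrite -fadd // => /finj ->; exists s.
Qed.

(** An isomorphism preserves the relation of being joined by an undirected walk,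
    so taking images is a bijection between the components. *)
Lemma digraph_iso_components (V W : Type) (a : V -> V -> Prop)
    (b : W -> W -> Prop) : digraph_iso a b ->
  (components a #= components b)%card.
Proof.
case=> f [[g fK gK] fab].
have fcl x y :
    clos_refl_sym_trans V a x y <-> clos_refl_sym_trans W b (f x) (f y).
  split.
    elim=> [u v /fab|u|u v _|u v w _ h1 _ h2].
    - exact: rst_step.
    - exact: rst_refl.
    - exact: rst_sym.
    - exact: rst_trans h1 h2.
  rewrite -[X in clos_refl_sym_trans V a X _]fK.
  rewrite -[X in clos_refl_sym_trans V a _ X]fK.
  elim=> [u v|u|u v _|u v w _ h1 _ h2].
  - by rewrite -[u]gK -[v]gK => /fab; rewrite !fK; exact: rst_step.
  - exact: rst_refl.
  - exact: rst_sym.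
  - exact: rst_trans h1 h2.
have fI : injective (fun A : set V => f @` A).
  move=> A B /= e; apply/seteqP; split=> x Ax.
    have : (f @` A) (f x) by exists x.
    by rewrite e => -[y By /(can_inj fK) <-].
  have : (f @` B) (f x) by exists x.
  by rewrite -e => -[y By /(can_inj fK) <-].
rewrite card_eq_sym.
have -> : components b = (fun A : set V => f @` A) @` components a.
  rewrite /components image_comp; apply/seteqP; split.
    move=> _ [y _ <-]; exists (g y) => //=.
    apply/seteqP; split=> z /=.
      by move=> [x /fcl h <-]; rewrite gK in h.
    by move=> h; exists (g z) => //; apply/fcl; rewrite !gK.
  move=> _ [x _ <-]; exists (f x) => //=.
  apply/seteqP; split=> z /=.
    by move=> h; exists (g z) => //; apply/fcl; rewrite !gK.
  by move=> [y /fcl h <-].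
by apply: inj_card_eq => A B _ _; exact: fI.
Qed.

(** Components are counted through any complete invariant of cosets. *)
Lemma card_components_invariant (G : zmodType) (S : set G) (T : Type)
    (q : G -> T) : (forall x y, q x = q y <-> gen S (x - y)) ->
  (components (Cay S) #= range q)%card.
Proof.
move=> qP; rewrite componentsE; set c := coset_of_gen S.
have qr x : q (xget 0 (c x)) = q x.
  have h : c x (xget 0 (c x)).
    by apply: xgetPex; exists x; rewrite /c /coset_of_gen /= subrr; exact: gen0.
  exact: (qP _ _).2 h.
have -> : range q = (fun C => q (xget 0 C)) @` range c.
  by rewrite image_comp; congr (_ @` _); apply/funext => x /=; rewrite qr.
rewrite card_eq_sym; apply: inj_card_eq => _ _ /set_mem[x _ <-] /set_mem[y _ <-].
by rewrite !qr => /qP /coset_eqP.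
Qed.

(** * Isomorphisms of Cayley digraphs on Z^n are affine on components *)

Section Harmonic.
Variables (G : zmodType) (ss : seq G).
Implicit Types (u v : G -> int).

Definition harmonic u := forall x, \sum_(s <- ss) u (x + s) = u x *+ size ss.

Lemma harmonic_shiftB u t : harmonic u -> harmonic (fun x => u (x + t) - u x).
Proof.
move=> hu x; rewrite sumrB mulrnBl -!hu; congr (_ - _).
by apply: eq_bigr => s _; rewrite addrAC.
Qed.

Lemma harmonicN u : harmonic u -> harmonic (fun x => - u x).
Proof. by move=> hu x; rewrite sumrN hu mulNrn. Qed.

Lemma max_attained u (B : int) : (forall x, u x <= B) ->
  exists x0, forall x, u x <= u x0.
Proof.
move=> uB; pose P m := `[< exists x, `|B - u x|%N = m >].
have exP : exists m, P m by exists `|B - u 0%R|%N; apply/asboolP; exists 0.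
case: (ex_minnP exP) => m /asboolP [x0 <-] mmin; exists x0 => x.
have /mmin : P `|B - u x|%N by apply/asboolP; exists x.
by have := uB x; have := uB x0; lia.
Qed.

(** The nonnegative numbers v x0 - v (x0 + s) add up to 0. *)
Lemma max_principle v x0 t : harmonic v -> (forall x, v x <= v x0) ->
  t \in ss -> v (x0 + t) = v x0.
Proof.
move=> hv vmax tss.
have : \sum_(s <- ss) (v x0 - v (x0 + s)) = 0.
  by rewrite sumrB hv big_const_seq count_predT iter_addr_0 subrr.
move/eqP; rewrite psumr_eq0 => [|s _]; last by rewrite subr_ge0.
by move=> /allP /(_ _ tss) /=; rewrite subr_eq0 => /eqP.
Qed.

(** The increment v x = u (x + t) - u x is harmonic and bounded; a positive
    maximum M of v would be taken along the whole ray of direction t from some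
    x0, and u would be unbounded on that ray. *)
Lemma bounded_harmonic_le u (B : int) t : harmonic u ->
  (forall x, `|u x| <= B) -> t \in ss -> forall x, u (x + t) <= u x.
Proof.
move=> hu uB tss x; rewrite -subr_le0.
pose v y := u (y + t) - u y.
have hv : harmonic v by exact: harmonic_shiftB.
have vB y : v y <= B + B.
  by rewrite /v; have := uB y; have := uB (y + t); lia.
have [x0 vmax] := max_attained vB.
apply: le_trans (vmax x) _; rewrite leNgt; apply/negP => vpos.
have step j : v (x0 + t *+ j) = v x0.
  elim: j => [|j IHj]; first by rewrite mulr0n addr0.
  rewrite mulrSr addrA -IHj; apply: max_principle => // y.
  by rewrite IHj.
have climb j : u (x0 + t *+ j) = u x0 + v x0 * j%:Z.
  elim: j => [|j IHj]; first by rewrite mulr0n mulr0 !addr0.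
  have := step j; rewrite {1}/v -addrA -mulrSr => /eqP.
  rewrite subr_eq => /eqP ->; rewrite IHj; lia.
have := uB (x0 + t *+ (`|B| + `|B|).+1); rewrite climb; have := uB x0; nia.
Qed.

Lemma bounded_harmonic_shift u (B : int) t : harmonic u ->
  (forall x, `|u x| <= B) -> t \in ss -> forall x, u (x + t) = u x.
Proof.
move=> hu uB tss x; apply/eqP; rewrite eq_le (bounded_harmonic_le hu uB) //=.
rewrite -lerN2; apply: (bounded_harmonic_le (harmonicN hu) (B := B)) => // y.
by rewrite normrN.
Qed.

End Harmonic.

(** The increments f (x + s) - f x are the elements of S', whatever x is; their
    sum is therefore constant, so the coordinates of x |-> f (x + h) - f x, for h
    in S, are bounded and harmonic. Their invariance under translation by S is
    the additivity of f - f 0. *)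
Lemma arc_preserving_additive (G : zmodType) n (S : set G) (S' : set 'rV[int]_n)
    (f : G -> 'rV[int]_n) : finite_set S -> injective f ->
  (forall x, [set f (x + s) - f x | s in S] = S') ->
  additive_on (gen S) (fun x => f x - f 0).
Proof.
move=> /finite_seqP [s0 S_s0] f_inj fS; pose ss := undup s0.
have ssP x : x \in ss <-> S x by rewrite mem_undup S_s0.
pose D x := [seq f (x + s) - f x | s <- ss].
have DP x y : y \in D x <-> S' y.
  rewrite -(fS x); split=> [/mapP [s sss ->]|[s Ss <-]].
    by exists s => //; exact/ssP.
  by apply/mapP; exists s => //; exact/ssP.
have D_uniq x : uniq (D x).
  rewrite map_inj_uniq ?undup_uniq // => s t /addIr /f_inj e; exact: addrI e.
have D_perm x y : perm_eq (D x) (D y).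
  apply: uniq_perm => // z; apply/idP/idP => /DP h; exact/DP.
have D_sum x : \sum_(s <- ss) (f (x + s) - f x) = \sum_(y <- D 0) y.
  rewrite -(big_map (fun s => f (x + s) - f x) xpredT id).
  exact: perm_big (D_perm x 0).
have grad_const h t x :
    S h -> S t -> f (x + t + h) - f (x + t) = f (x + h) - f x.
  move=> Sh St; apply/rowP => i.
  pose u z := (f (z + h) - f z) 0 i.
  pose B : int := \sum_(y <- D 0) `|y 0 i|.
  have uB z : `|u z| <= B.
    have : f (z + h) - f z \in D 0.
      by apply/DP; rewrite -(fS z); exists h.
    rewrite /B => /(big_rem _) -> /=; rewrite lerDl; exact: sumr_ge0.
  have hu : harmonic ss u.
    move=> z; rewrite -[size ss]count_predT -iter_addr_0 -big_const_seq.
    apply/eqP; rewrite -subr_eq0 -sumrB /u.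
    (* the sum of the increments of f is the same at z + h and at z *)
    have := D_sum (z + h); rewrite -(D_sum z) => /rowP /(_ i) /eqP.
    rewrite -subr_eq0 !summxE -sumrB; congr (_ == _); apply: eq_bigr => s _.
    rewrite !mxE (addrAC z). ring.
  have tss : t \in ss by exact: (ssP t).2.
  exact: (bounded_harmonic_shift hu uB tss x).
have grad_gen h k x :
    S h -> gen S k -> f (x + k + h) - f (x + k) = f (x + h) - f x.
  move=> Sh; move: k x.
  set A := [set k | forall x, f (x + k + h) - f (x + k) = f (x + h) - f x].
  suff gA : gen S `<=` A by move=> k x /gA; apply.
  apply: gen_min => [t St x|x|k l Ak Al x].
  - exact: grad_const.
  - by rewrite addr0.
  - by have := Al (x + (k - l)); rewrite -(addrA x (k - l) l) subrK Ak => ->.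
pose A := [set h | gen S h /\ forall x, gen S x -> f (x + h) - f x = f h - f 0].
have gA : gen S `<=` A.
  apply: gen_min => [s Ss||h k [Sh Ah] [Sk Ak]].
  - split=> [|x Sx]; first exact: sub_gen.
    by have := grad_gen s x 0 Ss Sx; rewrite !add0r.
  - by split=> [|x _]; [exact: gen0|rewrite addr0 !subrr].
  - have Ahk x : gen S x -> f (x + (h - k)) = f x + f h - f k.
      move=> Sx; have := Ak (x + (h - k)); rewrite -addrA subrK => /(_ _) e.
      have /e {}e : gen S (x + (h - k)) by apply: genD => //; exact: genB.
      have e' := Ah x Sx; apply/rowP => j.
      move: e e' => /rowP /(_ j) + /rowP /(_ j); rewrite !mxE => e e'; lra.
    split=> [|x Sx]; first exact: genB.
    rewrite Ahk // -[X in _ = f X - _]add0r Ahk; last exact: gen0.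
    by apply/rowP => j; rewrite !mxE; lra.
move=> x y Sx Sy; have [_ /(_ (x - y) (genB Sx Sy))] := gA _ Sy.
rewrite subrK => /rowP e; apply/rowP => j; move: (e j).
by rewrite !mxE => {}e; lra.
Qed.

(** * Automorphisms of a group and of a subgroup *)

Lemma Aut_inverse (G : zmodType) (f : G -> G) : Aut G f ->
  exists g, [/\ Aut G g, cancel f g & cancel g f].
Proof.
case=> fB [g fK gK]; exists g; split=> //; split; last by exists f.
by move=> x y; rewrite -[in LHS](gK x) -[in LHS](gK y) -fB fK.
Qed.

Lemma Aut_comp (G : zmodType) (f g : G -> G) :
  Aut G f -> Aut G g -> Aut G (f \o g).
Proof.
move=> [fB fbij] [gB gbij]; split; last exact: bij_comp.
by move=> x y /=; rewrite gB fB.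
Qed.

Section Automorphisms.
Variable G : zmodType.
Implicit Types (S : set G) (f : G -> G).

Lemma Aut_additive_on (H : set G) f : Aut G f -> additive_on H f.
Proof. by case=> fB _ x y _ _; exact: fB. Qed.

Lemma Aut_injective_on_gen S f : Aut G f -> injective_on_gen S f.
Proof.
move=> fA; have [_ /bij_inj f_inj] := fA; move=> x _.
have f0 := additive_on0 (Aut_additive_on (H := gen S) fA).
by rewrite -{1}f0 => /f_inj.
Qed.

Lemma Aut_gen S S' f x : Aut G f -> f @` S = S' -> gen S' (f x) <-> gen S x.
Proof.
move=> fA <-; rewrite -gen_image; last exact: Aut_additive_on.
split=> [[y Sy]|Sx]; last by exists x.
by case: fA => _ /bij_inj f_inj /f_inj <-.
Qed.

Lemma gen_val_gen S (h : gen_type S) : gen S (gen_val h).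
Proof. by case: h => x Sx; exact: set_mem Sx. Qed.

Lemma gen_val_surj S x : gen S x -> exists h : gen_type S, gen_val h = x.
Proof. by move=> /mem_set Sx; exists (GenType Sx). Qed.

Lemma gen_val_inj S : injective (@gen_val G S).
Proof. exact: (@val_inj _ _ (gen_type S)). Qed.

Lemma gen_valB S (h k : gen_type S) : gen_val (h - k) = gen_val h - gen_val k.
Proof. exact: (raddfB (val : gen_type S -> G)). Qed.

(** Passage from self-maps of the ambient group that permute the subgroup to
    automorphisms of the subgroup as a group of its own; [extend_from_gen] is the
    way back. *)
Lemma restrict_to_gen S (phi : G -> G) : additive_on (gen S) phi ->
  injective_on_gen S phi -> phi @` gen S = gen S ->
  exists2 t, Aut (gen_type S) t & forall h, gen_val (t h) = phi (gen_val h).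
Proof.
move=> phiB phi_inj phiS.
have phiT (h : gen_type S) : exists k : gen_type S, gen_val k = phi (gen_val h).
  apply: gen_val_surj; rewrite -phiS; exists (gen_val h) => //.
  exact: gen_val_gen.
have [t tE] := choice phiT; exists t => //; split.
  move=> h k; apply: gen_val_inj; rewrite tE !gen_valB !tE phiB //;
    exact: gen_val_gen.
apply: inj_surj_bijective => [h k e|k].
  have SB : gen S (gen_val h - gen_val k) by apply: genB; exact: gen_val_gen.
  apply/gen_val_inj/eqP; rewrite -subr_eq0; apply/eqP/phi_inj => //.
  by rewrite phiB -?tE ?e ?subrr //; exact: gen_val_gen.
have := gen_val_gen k; rewrite -phiS => -[_ /gen_val_surj[h <-] e].
by exists h; apply: gen_val_inj; rewrite tE.
Qed.

Lemma extend_from_gen S (t : gen_type S -> gen_type S) :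
  Aut (gen_type S) t -> exists phi : G -> G,
  [/\ additive_on (gen S) phi, injective_on_gen S phi, phi @` gen S = gen S &
    forall h, phi (gen_val h) = gen_val (t h)].
Proof.
move=> tA; pose phi x := if insub x is Some h then gen_val (t h) else 0.
have phiE h : phi (gen_val h) = gen_val (t h).
  by rewrite /phi -[gen_val h]/(val h) valK.
have [tB /[dup] /bij_inj t_inj [u tK uK]] := tA.
have phiB : additive_on (gen S) phi.
  move=> _ _ /gen_val_surj[h <-] /gen_val_surj[k <-].
  by rewrite -gen_valB !phiE tB gen_valB.
exists phi; split=> //.
- move=> _ /gen_val_surj[h <-]; rewrite phiE -[0]/(gen_val (0 : gen_type S)).
  move/gen_val_inj => e; congr gen_val; apply: t_inj; rewrite e.
  by rewrite -[in RHS](subrr 0) tB subrr.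
- apply/seteqP; split=> [_ [_ /gen_val_surj[h <-] <-]|_ /gen_val_surj[k <-]].
    by rewrite phiE; exact: gen_val_gen.
  by exists (gen_val (u k)); [exact: gen_val_gen|rewrite phiE uK].
Qed.

End Automorphisms.

(** * Finitely generated subgroups of Z^n *)

Lemma card_finTypeT (T : finType) : ([set: T] #= `I_#|T|)%card.
Proof.
have -> : `I_#|T| = (fun x : T => nat_of_ord (enum_rank x)) @` setT.
  apply/seteqP; split=> [i /= iT|_ [x _ <-] /=]; last exact: ltn_ord.
  by exists (enum_val (Ordinal iT)) => //; rewrite enum_valK.
rewrite card_eq_sym; apply: inj_card_eq => x y _ _ /ord_inj; exact: enum_rank_inj.
Qed.

(** The general form of a finitely generated subgroup of Z^n: R is a change of
    coordinates, and the i-th new coordinate has to be a multiple of d_i. A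
    modulus d_i = 0 forces that coordinate to vanish. *)
Definition lattice n (R : 'M[int]_n) (d : 'rV[int]_n) : set 'rV[int]_n :=
  [set x | forall i, (d 0%R i %| (x *m R)%R 0%R i)%Z].

Lemma gen_rows n m (M : 'M[int]_(m, n)) :
  gen [set row i M | i in [set: 'I_m]] = range (fun c : 'rV_m => c *m M).
Proof.
apply/seteqP; split.
  apply: gen_min => [_ [i _ <-]||_ _ [c _ <-] [c' _ <-]].
  - by exists (delta_mx 0 i) => //; rewrite rowE.
  - by exists 0; rewrite ?mul0mx.
  - by exists (c - c'); rewrite ?mulmxBl.
move=> _ [c _ <-]; rewrite mulmx_sum_row.
set A := [set _ | _ in _].
have AM i : row i M \in gen_pred A 
  by have /mem_set : gen A (row i M) by apply: sub_gen; exists i.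
suff h : \sum_i c 0 i *: row i M \in gen_pred A by exact: set_mem h.
by apply: rpred_sum => i _; rewrite -[c 0 i]intz scaler_int rpredMz.
Qed.

(** If L D R is the Smith normal form of the matrix whose rows are the elements
    of S, the subgroup is the row span of D R, because L is invertible; hence in
    the coordinates x R^-1 it is the span of the rows of D. *)
Lemma smith_lattice n (S : set 'rV[int]_n) : finite_set S ->
  exists R d, [/\ R \in unitmx, gen S = lattice R d &
    forall i j : 'I_n, (i <= j)%N -> (d 0%R i %| d 0%R j)%Z].
Proof.
move=> /finite_seqP [s S_s].
pose M : 'M[int]_(size s, n) := \matrix_i s`_i.
have -> : S = [set row i M | i in [set: 'I_(size s)]].
  rewrite S_s; apply/seteqP; split=> [x /= xs|_ [i _ <-] /=].
    have xi : (index x s < size s)%N by rewrite index_mem.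
    by exists (Ordinal xi) => //; rewrite rowK nth_index.
  by rewrite rowK mem_nth.
have [L Lu [R Ru [d dS ->]]] := int_Smith_normal_form M.
(* columns of D beyond its last row are zero, whatever the list d contains *)
pose d' : 'rV[int]_n := \row_j (d`_j *+ (j < size s)%N).
exists (invmx R), d'; split; first by rewrite unitmx_inv.
- rewrite gen_rows; apply/seteqP; split=> [_ [c _ <-] j|x xd].
    rewrite !mulmxA mulmxK // mxE; apply: rpred_sum => i _.
    rewrite !mxE; case: (ltnP j (size s)) => js; rewrite ?mulr1n ?mulr0n.
      by apply/dvdz_mull; case: eqP => [->|_]; rewrite ?mulr1n ?dvdzz ?dvdz0.
    case: eqP => [ij|_]; rewrite ?mulr0n ?mulr0 //.
    by have := ltn_ord i; rewrite ij ltnNge js.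
  pose y : 'rV[int]_(size s) := \row_i
    if insub (val i) is Some j then ((x *m invmx R)%R 0%R j %/ d`_i)%Z else 0.
  exists (y *m invmx L) => //; rewrite !mulmxA mulmxKV //.
  rewrite -[RHS](mulmxKV Ru); congr (_ *m _); apply/rowP => j.
  rewrite mxE.
  have := xd j; rewrite [d' 0 j]mxE.
  case: (ltnP j (size s)) => js; rewrite ?mulr1n ?mulr0n.
    move=> xdj; rewrite (bigD1 (Ordinal js)) //= big1 => [|i ij].
      rewrite addr0 [y _ _]mxE [(\matrix_(_, _) _) _ _]mxE eqxx mulr1n /= valK.
      exact: divzK.
    rewrite !mxE; case: eqP => [e|_]; rewrite ?mulr0n ?mulr0 //.
    by case/eqP: ij; apply: val_inj.
  rewrite dvd0z => /eqP ->; rewrite big1 // => i _.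
  rewrite !mxE; case: eqP => [e|_]; rewrite ?mulr0n ?mulr0 //.
  by have := ltn_ord i; rewrite e ltnNge js.
- move=> i j ij; rewrite !mxE; case: (ltnP j (size s)) => js; last first.
    by rewrite mulr0n dvdz0.
  rewrite (leq_ltn_trans ij js) !mulr1n.
  case: (ltnP j (size d)) => jd; last by rewrite (nth_default _ jd) dvdz0.
  apply: (sorted_leq_nth dvdz_trans dvdzz 0 dS) => //.
  by rewrite inE (leq_ltn_trans ij).
Qed.

Section Lattice.
Variables (n : nat) (S : set 'rV[int]_n) (R : 'M[int]_n) (d : 'rV[int]_n).
Hypotheses (Ru : R \in unitmx) (SE : gen S = lattice R d).

(** The residues of the coordinates of x R modulo the d_i are a complete
    invariant of cosets, and all tuples of residues occur. *)
Lemma card_components_lattice : (forall i, d 0 i != 0) ->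
  (components (Cay S) #= `I_(\prod_i `|d 0%R i|)%N)%card.
Proof.
move=> d0; pose m i := `|d 0%R i|%N.
pose T := {dffun forall i : 'I_n, 'I_(m i)}.
have lt_m (x : 'rV[int]_n) i : (`|((x *m R)%R 0%R i %% d 0%R i)%Z| < m i)%N.
  have := modz_ge0 ((x *m R) 0 i) (d0 i).
  by have := ltz_mod ((x *m R) 0 i) (d0 i); rewrite /m; lia.
pose q x : T := [ffun i => Ordinal (lt_m x i)].
have qP x y : q x = q y <-> gen S (x - y).
  rewrite SE /lattice /=; split=> [/ffunP e i|e].
    have := congr1 val (e i); rewrite !ffunE /= => {}e.
    rewrite mulmxBl !mxE -eqz_mod_dvd.
    have := modz_ge0 ((x *m R) 0 i) (d0 i).
    have := modz_ge0 ((y *m R) 0 i) (d0 i).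
    rewrite !mxE in e *; lia.
  apply/ffunP => i; rewrite !ffunE; apply: val_inj => /=.
  by have := e i; rewrite mulmxBl !mxE -eqz_mod_dvd => /eqP ->.
have -> : (\prod_i `|d 0%R i|)%N = #|T|.
  rewrite card_dep_ffun foldrE big_map big_enum.
  by apply: eq_bigr => i _; rewrite card_ord.
apply: card_eq_trans (card_components_invariant qP) _.
suff -> : range q = [set: T] by exact: card_finTypeT.
apply/seteqP; split=> // t _.
exists ((\row_i (nat_of_ord (t i))%:Z) *m invmx R) => //.
apply/ffunP => i; rewrite ffunE; apply: val_inj => /=.
(* d_i may be negative, whereas residues lie between 0 and its absolute value *)
rewrite mulmxKV // mxE -modz_abs modz_small //.
by have := ltn_ord (t i); rewrite /m; lia.
Qed.

(** If d_i = 0, the multiples of the i-th basis vector of the new coordinates lie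
    in pairwise distinct cosets. *)
Lemma finite_components_lattice : finite_set (components (Cay S)) ->
  forall i, d 0 i != 0.
Proof.
rewrite componentsE => fin i; apply/eqP => di0.
pose x (j : nat) : 'rV[int]_n := (j%:Z *: delta_mx 0 i) *m invmx R.
apply: infinite_nat; suff : finite_set ((fun j => coset_of_gen S (x j)) @` setT).
  rewrite (eq_finite_set (B := [set: nat])) //.
  apply: inj_card_eq => j k _ _ /coset_eqP; rewrite SE => /(_ i).
  rewrite di0 dvd0z /x -mulmxBl mulmxKV // !mxE !eqxx !mulr1; lia.
by apply: sub_finite_set fin => _ [j _ <-]; exists (x j).
Qed.

End Lattice.

Lemma card_lattice_index n (S : set 'rV[int]_n) (R : 'M[int]_n)
    (d : 'rV[int]_n) k : R \in unitmx -> gen S = lattice R d ->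
  (components (Cay S) #= `I_k)%card ->
  (forall i, d 0 i != 0) /\ k = (\prod_i `|d 0%R i|)%N.
Proof.
move=> Ru SE compk.
have d0 : forall i, d 0 i != 0.
  by apply: finite_components_lattice Ru SE _; exists k.
split=> //; apply/card_eq_II.
rewrite card_eq_sym in compk; apply: card_eq_trans compk _.
exact: card_components_lattice Ru SE d0.
Qed.

(** For i < n the modulus d_i divides the last one d_n, so its square divides the
    index k = |d_1 ... d_n| and d_i is a unit. The quotient of Z^n is thus cyclic. *)
Lemma squarefree_lattice n (S : set 'rV[int]_n.+1) k : finite_set S ->
  (components (Cay S) #= `I_k)%card -> squarefree k ->
  exists2 R : 'M[int]_n.+1, R \in unitmx &
    gen S = [set x | (k%:Z %| (x *m R)%R 0%R ord_max)%Z].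
Proof.
move=> Sfin compk sqk.
have [R [d [Ru SE dd]]] := smith_lattice Sfin.
have [d0 kE] := card_lattice_index Ru SE compk.
exists R => //.
have d1 (i : 'I_n.+1) : i != ord_max -> `|d 0%R i|%N = 1%N.
  (* the factors of index i and n are both multiples of d_i *)
  move=> imax; apply: sqk; rewrite kE (bigD1 ord_max) //= (bigD1 i) //= mulnA.
  apply: dvdn_mulr; rewrite -mulnn; apply: dvdn_mul => //.
  have := dd i ord_max (leq_ord i); by rewrite dvdzE.
have kmax : k = `|d 0%R ord_max|%N.
  by rewrite kE (bigD1 ord_max) //= big1 ?muln1 // => i; exact: d1.
rewrite SE; apply/seteqP; split=> x /= Sx => [|i].
  by have := Sx ord_max; rewrite !dvdzE kmax.
case: (eqVneq i ord_max) => [->|/d1 di].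
  by move: Sx; rewrite !dvdzE kmax.
by rewrite dvdzE di dvd1n.
Qed.

Lemma squarefree_lattice_aut n (S S' : set 'rV[int]_n.+1) k :
  finite_set S -> finite_set S' -> squarefree k ->
  (components (Cay S) #= `I_k)%card -> (components (Cay S') #= `I_k)%card ->
  exists2 f, Aut _ f & f @` gen S = gen S'.
Proof.
move=> Sfin S'fin sqk compk comp'k.
have [R Ru ->] := squarefree_lattice Sfin compk sqk.
have [R' Ru' ->] := squarefree_lattice S'fin comp'k sqk.
exists (fun x => x *m R *m invmx R').
  split; first by move=> x y; rewrite !mulmxBl.
  by exists (fun x => x *m R' *m invmx R) => x; rewrite mulmxKV // mulmxK.
apply/seteqP; split=> [_ [x Sx <-] /=|x Sx]; first by rewrite mulmxKV.
by exists (x *m R' *m invmx R) => /=; rewrite mulmxKV // mulmxK.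
Qed.

(** * Consequences of the (D)CI property *)

(** The common algebraic content of the CI and DCI properties: such a phi gives an
    isomorphism onto Cay(G; phi(S)), and phi(S) is symmetric when S is. *)
Definition realizes_embeddings (G : zmodType) (S : set G) :=
  forall phi : G -> G,
  additive_on (gen S) phi -> injective_on_gen S phi ->
  (components (Cay S) #= components (Cay (phi @` S)))%card ->
  exists2 f, Aut G f & f @` S = phi @` S.

Lemma image_avoids0 (G : zmodType) (S : set G) (phi : G -> G) :
  injective_on_gen S phi ->
  ~ S 0 -> ~ (phi @` S) 0.
Proof.
move=> phi_inj S0 [s Ss /phi_inj s0]; apply: S0.
by rewrite -s0 //; exact: sub_gen.
Qed.

Lemma is_DCI_realizes (G : zmodType) (S : set G) :
  ~ S 0 -> is_DCI S -> realizes_embeddings S.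
Proof.
move=> S0 dci phi phiB phi_inj comps; apply: dci; first exact: image_avoids0.
exact: digraph_iso_image.
Qed.

Lemma is_CI_realizes (G : zmodType) (S : set G) :
  ~ S 0 -> symmetric_set S -> is_CI S -> realizes_embeddings S.
Proof.
move=> S0 symS ci phi phiB phi_inj comps; apply: ci; first exact: image_avoids0.
  rewrite /symmetric_set image_comp -{2}symS image_comp; apply: eq_imagel.
  by move=> s Ss /=; rewrite (additive_onN phiB) //; exact: sub_gen.
exact: digraph_iso_image.
Qed.

(** An automorphism f of G with f(S) = t(S) preserves the subgroup, where it
    restricts to an extendable t1, and t1^-1 t stabilizes S. *)
Lemma realizes_Aut_gen (G : zmodType) (S : set G) : realizes_embeddings S ->
  Aut (gen_type S) = [set t1 \o t2 | t1 in Aut_ext S & t2 in Stab S].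
Proof.
move=> real; apply/seteqP; split=> [t tA|_ [t1 [t1A _]] [t2 [t2A _] <-]]; last first.
  case: t1A t2A => [t1B t1bij] [t2B t2bij].
  by split=> [x y /=|]; [rewrite t2B t1B|exact: bij_comp].
have [phi [phiB phi_inj phiS phiE]] := extend_from_gen tA.
have phi_gen : gen (phi @` S) = gen S by rewrite -gen_image.
have [|f fA fS] := real phi phiB phi_inj.
  by rewrite !componentsE /coset_of_gen phi_gen; exact: card_eqxx.
have fB := Aut_additive_on (H := gen S) fA.
have [|t1 t1A t1E] := restrict_to_gen fB (Aut_injective_on_gen (S := S) fA).
  by rewrite gen_image // fS.
have [u [uA t1K uK]] := Aut_inverse t1A.
exists t1; first by split=> //; exists f.
exists (u \o t); last by apply/funext => h /=; rewrite uK.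
split; first exact: Aut_comp.
apply/seteqP; split=> [_ [h Sh <-]|h Sh] /=.
  have : (phi @` S) (gen_val (t h)) by rewrite -phiE; exists (gen_val h).
  rewrite -fS => -[s Ss]; have [k ks] := gen_val_surj (sub_gen Ss).
  by rewrite -ks -t1E => /gen_val_inj <-; rewrite t1K ks.
have : (f @` S) (f (gen_val h)) by exists (gen_val h).
rewrite fS => -[s Ss]; have [k ks] := gen_val_surj (sub_gen Ss).
rewrite -ks phiE -t1E => /gen_val_inj e; exists k; first by rewrite ks.
by rewrite /= e t1K.
Qed.

(** The image of S under doubling generates a subgroup of infinite index as soon
    as S does, so an automorphism f carries S to 2S. Then s = f^-1(2s') for
    some s' in S, so every element of S is divisible by 2^k for all k. *)
Lemma realizes_finite n (S : set 'rV[int]_n) : ~ S 0 -> S !=set0 ->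
  realizes_embeddings S -> finite_set (components (Cay S)).
Proof.
move=> S0 [s0 Ss0] real; apply: contrapT => inf.
pose phi (x : 'rV[int]_n) := x + x.
have phiB (H : set 'rV[int]_n) : additive_on H phi.
  by move=> x y _ _; rewrite /phi opprD addrACA.
have phi_eq x y : phi x = phi y -> x = y.
  by move=> /rowP e; apply/rowP => i; have := e i; rewrite !mxE => {}e; lra.
have phi0 : phi 0 = 0 by exact: addr0.
have phi_inj : injective_on_gen S phi.
  by move=> x _; rewrite -[X in _ = X -> _]phi0 => /phi_eq.
have countable_comps (T : set 'rV[int]_n) : countable (components (Cay T)).
  rewrite componentsE; apply: card_le_trans (card_image_le _ _) _.
  exact: countableP.
have inf' : infinite_set (components (Cay (phi @` S))).
  move=> fin; apply: inf.
  rewrite componentsE; set c := coset_of_gen S.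
  have -> : range c = (fun C => c (xget 0 C)) @` components (Cay (phi @` S)).
    rewrite componentsE image_comp; congr (_ @` _); apply/funext => x /=.
    have : coset_of_gen (phi @` S) x (xget 0 (coset_of_gen (phi @` S) x)).
      by apply: xgetPex; exists x; rewrite /coset_of_gen /= subrr; exact: gen0.
    rewrite {1}/coset_of_gen /= -gen_image // => -[h Sh e].
    have h' : gen S (phi h) by exact: genD.
    by rewrite e in h'; exact: (coset_eqP S _ _).2 (genBC h').
  exact: finite_image.
have [|f fA fS] := real phi (phiB _) phi_inj.
  apply: card_eq_trans (_ : _ #= [set: nat])%card _.
    exact/eq_card_nat.
  by rewrite card_eq_sym; exact/eq_card_nat.
have [g [gA fK gK]] := Aut_inverse fA.
have div2 k s : S s -> exists y, s = y *+ 2 ^ k.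
  elim: k s => [|k IHk] s Ss; first by exists s; rewrite expn0 mulr1n.
  have : (phi @` S) (f s) by rewrite -fS; exists s.
  case=> r /IHk[y ->] e; exists (g y).
  apply: (can_inj fK); rewrite -e /phi -mulr2n -mulrnA -expnSr.
  have [fB _] := fA; pose fa := GRing.isZmodMorphism.Build _ _ f fB.
  pose f' : {additive 'rV[int]_n -> 'rV[int]_n} := HB.pack f fa.
  by rewrite -[f]/(f' : _ -> _) raddfMn /= gK.
apply: S0; suff <- : s0 = 0 by [].
apply/rowP => i; rewrite mxE.
have [y] := div2 `|s0 0%R i|%N _ Ss0 => /rowP /(_ i).
have := ltn_expl `|s0 0%R i|%N (isT : 1 < 2)%N.
rewrite mulmxnE; move: (s0 _ i) (y _ i) (2 ^ _)%N => a b m.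
rewrite -mulr_natr natz => + e.
by rewrite e abszM absz_nat; case: b {e} => [[|b]|b] /=; rewrite ?mul0r //; nia.
Qed.

(** Dividing the i-th coordinate by d_i and multiplying it by d'_i is an
    isomorphism between the two lattices, which have the same index. *)
Lemma realizes_lattice n (S : set 'rV[int]_n) (R : 'M[int]_n)
    (d d' : 'rV[int]_n) : realizes_embeddings S ->
  R \in unitmx -> gen S = lattice R d -> (forall i, d 0 i != 0) ->
  (forall i, d' 0 i != 0) ->
  (\prod_i `|d 0%R i| = \prod_i `|d' 0%R i|)%N ->
  exists2 f, Aut _ f & forall x, lattice 1%:M d' (f x) <-> gen S x.
Proof.
move=> real Ru SE d0 d'0 dd'.
pose phi (x : 'rV[int]_n) : 'rV[int]_n :=
  \row_i (((x *m R)%R 0%R i %/ d 0%R i)%Z * d' 0 i).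
have phiE z i : phi z 0 i = ((z *m R)%R 0%R i %/ d 0%R i)%Z * d' 0 i.
  by rewrite mxE.
have phiB : additive_on (gen S) phi.
  rewrite SE => x y Sx Sy; apply/rowP => i.
  have [a ea] := dvdzP (Sx i); have [b eb] := dvdzP (Sy i).
  have entryB (u v : 'rV[int]_n) : (u - v) 0 i = u 0 i - v 0 i by rewrite !mxE.
  have eab : ((x - y) *m R) 0 i = (a - b) * d 0 i.
    by rewrite mulmxBl entryB ea eb mulrBl.
  rewrite entryB !phiE.
  by rewrite eab ea eb !mulzK // mulrBl.
have phi_inj : injective_on_gen S phi.
  rewrite /injective_on_gen SE => x Sx /rowP e.
  rewrite -(mulmxK Ru x); suff -> : x *m R = 0 by rewrite mul0mx.
  apply/rowP => i; have := e i; rewrite phiE [X in _ = X]mxE => /eqP.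
  rewrite mulf_eq0 (negPf (d'0 i)) orbF => /eqP q0.
  by rewrite [RHS]mxE -(divzK (Sx i)) q0 mul0r.
have S'E : gen (phi @` S) = lattice 1%:M d'.
  rewrite -gen_image // SE; apply/seteqP; split=> [_ [x Sx <-] i|y yd].
    by rewrite mulmx1 phiE dvdz_mull.
  pose z : 'rV[int]_n := \row_i ((y 0%R i %/ d' 0%R i)%Z * d 0 i).
  exists (z *m invmx R).
    by move=> i; rewrite mulmxKV // mxE dvdz_mull.
  apply/rowP => i; rewrite phiE mulmxKV // [z _ _]mxE mulzK // divzK //.
  by have := yd i; rewrite mulmx1.
have [|f fA fS] := real phi phiB phi_inj.
  apply: card_eq_trans (card_components_lattice Ru SE d0) _.
  rewrite dd' card_eq_sym.
  by apply: card_components_lattice S'E d'0; exact: unitmx1.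
by exists f => // x; rewrite -S'E; exact: Aut_gen.
Qed.

(** Divisibility of m by the exponent of the quotient, an invariant under
    automorphisms, read off from the moduli. It separates lattices of the same
    index. *)
Lemma lattice_period n (S : set 'rV[int]_n) (f : 'rV[int]_n -> 'rV[int]_n)
    (d : 'rV[int]_n) (m : nat) : Aut _ f ->
  (forall x, lattice 1%:M d (f x) <-> gen S x) ->
  (forall x, gen S (x *+ m)) <-> forall i, (d 0%R i %| m%:Z)%Z.
Proof.
move=> fA fS; have [g [gA fK gK]] := Aut_inverse fA.
have [fB _] := fA; pose fa := GRing.isZmodMorphism.Build _ _ f fB.
pose f' : {additive 'rV[int]_n -> 'rV[int]_n} := HB.pack f fa.
have fMn x : f (x *+ m) = f x *+ m by exact: (raddfMn f').
split=> [Sm i|dm x].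
  have /fS := Sm (g (delta_mx 0 i)).
  rewrite fMn gK => /(_ i).
  by rewrite mulmx1 mulmxnE mxE !eqxx mulr1n natz.
apply/fS => i; rewrite fMn mulmx1 mulmxnE -mulr_natr natz.
exact: dvdz_mull (dm i).
Qed.

(** If e^2 divides k = e m, the lattices with moduli (k, 1, 1, ...) and
    (e, m, 1, ...) have index k, so both are images of the subgroup under
    automorphisms. As m annihilates the second quotient, it annihilates the
    first one, so k divides m and e = 1. *)
Lemma realizes_squarefree n (S : set 'rV[int]_n.+2) k : finite_set S ->
  realizes_embeddings S -> (components (Cay S) #= `I_k)%card -> squarefree k.
Proof.
move=> Sfin real compk e e2k.
have [R [d [Ru SE _]]] := smith_lattice Sfin.
have [d0 kE] := card_lattice_index Ru SE compk.
have k0 : (0 < k)%N.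
  by rewrite kE prodn_gt0 // => i; rewrite absz_gt0.
have ek : (e %| k)%N by apply: dvdn_trans e2k; exact: dvdn_mulr.
pose m := (k %/ e)%N.
have kem : k = (e * m)%N by rewrite mulnC divnK.
have [e0 m0] : (0 < e)%N /\ (0 < m)%N by apply/andP; rewrite -muln_gt0 -kem.
have em : (e %| m)%N by rewrite -(dvdn_pmul2l e0) -kem mulnn.
pose diag (a b : nat) : 'rV[int]_n.+2 :=
  \row_i (if i == ord0 then a else if i == lift ord0 ord0 then b else 1%N)%:Z.
have period a b : (0 < a)%N -> (0 < b)%N -> (a * b)%N = k ->
    (forall x, gen S (x *+ m)) <-> (a %| m)%N && (b %| m)%N.
  move=> a0 b0 abk.
  have dE i : diag a b 0 i =
      (if i == ord0 then a else if i == lift ord0 ord0 then b else 1%N)%:Z.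
    by rewrite mxE.
  have [|| f fA fS] := realizes_lattice (d' := diag a b) real Ru SE d0.
  - by move=> i; rewrite dE; case: ifP => _; [|case: ifP => _]; lia.
  - rewrite -kE -abk (bigD1 ord0) //= (bigD1 (lift ord0 ord0)) //= big1 => [|i].
      by rewrite !dE /= muln1.
    by rewrite dE => /andP[/negPf -> /negPf ->].
  rewrite (lattice_period m fA fS); split=> [dm|/andP[am bm] i].
    by have := dm ord0; have := dm (lift ord0 ord0); rewrite !dvdzE !dE /= => -> ->.
  by rewrite dvdzE dE; case: ifP => _ //; case: ifP => _ //; exact: dvd1n.
have : (k %| m)%N && (1 %| m)%N.
  apply/period; rewrite ?muln1 //; apply/(period e m) => //.
  by rewrite em dvdnn.
case/andP => /dvdn_leq; rewrite kem m0 => /(_ isT) + _; nia.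
Qed.

(** * From the two conditions to the DCI property *)

(** An isomorphism onto Cay(Z^n; S') that fixes 0 restricts to an isomorphism phi
    from the subgroup H to the subgroup H' generated by S'. If f is an
    automorphism of Z^n from H to H', then f^-1 phi is an automorphism of H,
    hence of the form t1 t2 with t1 the restriction of an automorphism e of Z^n
    and t2(S) = S. The automorphism f e carries S to f t1 t2 (S) = phi(S) = S'. *)
Lemma is_DCI_of_lattice_aut n (S : set 'rV[int]_n) : finite_set S ->
  (forall S' : set 'rV[int]_n, finite_set S' ->
     (components (Cay S) #= components (Cay S'))%card ->
     exists2 f, Aut _ f & f @` gen S = gen S') ->
  Aut (gen_type S) = [set t1 \o t2 | t1 in Aut_ext S & t2 in Stab S] ->
  is_DCI S.
Proof.
move=> Sfin latAut AutE S' S'0 iso.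
have comps := digraph_iso_components iso.
have [F [Fbij Farc]] := iso; have F_inj := bij_inj Fbij.
have FS x : [set F (x + s) - F x | s in S] = S'.
  apply/seteqP; split=> [_ [s Ss <-]|s' Ss'].
    have /Farc [s' Ss' ->] : Cay S x (x + s) by exists s.
    by rewrite addrAC subrr add0r.
  have [F' _ F'K] := Fbij.
  have /Farc [s Ss e] : Cay S' (F x) (F (F' (F x + s'))) by rewrite F'K; exists s'.
  by exists s => //; rewrite -e F'K addrAC subrr add0r.
pose phi x := F x - F 0.
have phiB : additive_on (gen S) phi by exact: arc_preserving_additive FS.
have phi_inj : injective_on_gen S phi.
  by move=> x _ /eqP; rewrite subr_eq0 => /eqP /F_inj.
have phiS : phi @` S = S'.
  by rewrite -(FS 0); apply: eq_imagel => s _; rewrite add0r.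
have S'fin : finite_set S' by rewrite -phiS; exact: finite_image.
have [f fA fS] := latAut S' S'fin comps.
have [g [gA fK gK]] := Aut_inverse fA.
have gB := Aut_additive_on (H := setT) gA.
have psiB : additive_on (gen S) (g \o phi).
  by move=> x y Sx Sy /=; rewrite phiB // gB.
have psi_inj : injective_on_gen S (g \o phi).
  move=> x Sx /= /(congr1 f).
  rewrite gK (additive_on0 (S := S)); last exact: Aut_additive_on.
  exact: phi_inj.
have [|t tA tE] := restrict_to_gen psiB psi_inj.
  rewrite -image_comp gen_image // phiS -fS image_comp.
  by apply/seteqP; split=> [_ [x Sx <-] /=|x Sx]; [rewrite fK|exists x => //=].
have : Aut (gen_type S) t by [].
rewrite AutE => -[t1 [t1A [e eA eE]] [t2 [t2A t2S] t12]].
exists (f \o e); first exact: Aut_comp.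
have key h : f (e (gen_val (t2 h))) = phi (gen_val h).
  by rewrite eE -[t1 (t2 h)]/((t1 \o t2) h) t12 tE /= gK.
rewrite -phiS; apply/seteqP; split=> [_ [s Ss <-]|_ [s Ss <-]] /=.
  have [h hs] := gen_val_surj (sub_gen Ss).
  have : (@gen_val _ S @^-1` S) h by rewrite /= hs.
  by rewrite -t2S => -[k kS kh]; rewrite -hs -kh key; exists (gen_val k).
have [h hs] := gen_val_surj (sub_gen Ss).
exists (gen_val (t2 h)); last by rewrite -hs key.
suff : (@gen_val _ S @^-1` S) (t2 h) by [].
by rewrite -t2S; exists h => //; rewrite /= hs.
Qed.

Theorem theorem6p3 (n : nat) (hn : (1 < n)%N) (S : set 'rV[int]_n)
    (S0 : ~ S 0) (Sfin : finite_set S) (Sne : S !=set0) :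
  let conditions :=
    (exists2 k : nat, (components (Cay S) #= `I_k)%card & squarefree k) /\
    Aut (gen_type S) =
      [set t1 \o t2 | t1 in Aut_ext S & t2 in Stab S] in
  (is_DCI S <-> conditions) /\
  (symmetric_set S -> (is_CI S <-> conditions)).
Proof.
case: n hn S S0 Sfin Sne => [//|[//|n]] _ S S0 Sfin Sne conditions.
have realizes_conditions : realizes_embeddings S -> conditions.
  move=> real; split; last exact: realizes_Aut_gen.
  have [k compk] := realizes_finite S0 Sne real.
  by exists k => //; exact: realizes_squarefree compk.
have conditions_DCI : conditions -> is_DCI S.
  case=> [[k compk sqk] AutE]; apply: is_DCI_of_lattice_aut => // S' S'fin comps.
  rewrite card_eq_sym in comps; have comp'k := card_eq_trans comps compk.
  exact: squarefree_lattice_aut Sfin S'fin sqk compk comp'k.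
split; first by split=> [/(is_DCI_realizes S0)|].
move=> symS; split=> [/(is_CI_realizes S0 symS) //|/conditions_DCI dci].
by move=> S' S'0 _; exact: dci.
Qed.
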